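(* Let $G=(V,E)$ be a finite, strongly connected directed graph and let $(X_n)_{n\in\mathbb{N}}$ be a locally Markov walk on $G$ whose local chains, with transition matrices $\mathsf{M}_x=(\mathsf{m}_x(y,z))_{y,z\in N_x}$, are irreducible and aperiodic for every $x\in V$. Then the recurrent states of the associated total chain $(X_n,\rho_n)_{n\in\mathbb{N}}$ are exactly the states $(x,\rho)$ such that $\rho$ is a spanning unicycle of $G$ and $x$ lies on the unique cycle of $\rho$.
   Context: Graph: $G=(V,E)$ is a finite directed graph without loops or multiple edges, strongly connected, $|V|\ge 2$; $N_x=\{y\in V:(x,y)\in E\}$. Local chains: for every $x\in V$ a stochastic matrix $\mathsf{M}_x=(\mathsf{m}_x(y,z))_{y,z\in N_x}$ is given, the transition matrix of the local chain at $x$. Configurations: a configuration is a map $\rho:V\to V$ with $\rho(x)\in N_x$ for all $x$. Locally Markov walk and total chain: a locally Markov walk with these local chains is a $V$-valued process $(X_n)_{n\in\mathbb{N}}$ such that, for an initial configuration $\rho_0$ and with $\rho_n(x)$ denoting the vertex to which the walk moved at its most recent exit from $x$ before time $n$ ($\rho_n(x)=\rho_0(x)$ if there was none), the process $(X_n,\rho_n)_{n\in\mathbb{N}}$, called the total chain, is a Markov chain (on the set of pairs of a vertex and a configuration) with one-step transition probabilities $$p((x,\rho),(y,\eta))=\begin{cases}\mathsf{m}_x(\rho(x),y),&\text{if }\eta(v)=\rho(v)\text{ for all }v\ne x\text{ and }\eta(x)=y,\\0,&\text{otherwise.}\end{cases}$$ A configuration $\rho$ is a spanning unicycle of $G$ if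 the spanning subgraph with edge set $\{(v,\rho(v)):v\in V\}$ contains exactly one directed cycle (then from every vertex there is a unique directed path to this cycle). *)

(* Defs.v *)
From HB Require Import structures.
From mathcomp Require Import all_boot all_order all_algebra.
From mathcomp Require Import all_classical all_reals all_analysis.

Set Implicit Arguments.
Unset Strict Implicit.
Unset Printing Implicit Defensive.

Import Order.TTheory GRing.Theory Num.Theory.
Import numFieldNormedType.Exports.

Local Open Scope classical_set_scope.
Local Open Scope ring_scope.

Section FiniteMarkovChain.
Variables (R : realType) (S : finType) (p : S -> S -> R).

Definition stochastic : Prop :=
  (forall s t, 0 <= p s t) /\ (forall s, \sum_t p s t = 1).

Fixpoint nstep (n : nat) (s t : S) : R :=
  if n is k.+1 then \sum_u p s u * nstep k u t else (s == t)%:R.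

Definition irreducible : Prop :=
  forall s t, exists n, 0 < nstep n s t.

(* The greatest common divisor of the set of return times is 1. *)
Definition aperiodic : Prop :=
  forall s (e : nat),
    (forall n, (0 < n)%N -> 0 < nstep n s s -> (e %| n)%N) -> e = 1%N.

(* P_s (Z_1 = w_1, ..., Z_k = w_k) for the chain Z started from s. *)
Fixpoint path_prob (s : S) (w : seq S) : R :=
  if w is t :: w' then p s t * path_prob t w' else 1.

(* P_s (tau = n + 1), where tau is the first time k >= 1 with Z_k = s. *)
Definition first_return (s : S) (n : nat) : R :=
  \sum_(w : n.-tuple S | s \notin w) path_prob s (rcons w s).

(* P_s (tau < oo) = 1. *)
Definition recurrent (s : S) : Prop :=
  series (first_return s) @ \oo --> (1 : R).

End FiniteMarkovChain.

Definition strongly_connected (V : finType) (E : rel V) : Prop :=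
  forall x y, connect E x y.

(* Up to rotation, [c] lists the vertices of a directed cycle of [e]. *)
Definition dicycle (V : finType) (e : rel V) (c : seq V) : Prop :=
  c != [::] /\ ucycle e c.

Definition unique_dicycle (V : finType) (e : rel V) : Prop :=
  exists2 c, dicycle e c & forall c', dicycle e c' -> exists k, c' = rot k c.

Definition nbr (V : finType) (E : rel V) (x : V) : finType := {y : V | E x y}.

Definition config (V : finType) (E : rel V) : finType :=
  {dffun forall x : V, nbr E x}.

Definition config_graph (V : finType) (E : rel V) (rho : config E) : rel V :=
  [rel v w | val (rho v) == w].

Definition spanning_unicycle (V : finType) (E : rel V) (rho : config E) : Prop :=
  unique_dicycle (config_graph rho).

Definition on_cycle (V : finType) (E : rel V) (rho : config E) (x : V) : Prop :=
  exists2 c, dicycle (config_graph rho) c & x \in c.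

Section LocallyMarkovWalk.
Variables (R : realType) (V : finType) (E : rel V).
Variable m : forall x : V, nbr E x -> nbr E x -> R.

Definition state : finType := (V * config E)%type.

(* In the first case the new position [t.1] is [t.2 s.1], so the local chain
   at [s.1] moves from [s.2 s.1] to [t.2 s.1]. *)
Definition total_chain (s t : state) : R :=
  if [forall v, (v != s.1) ==> (t.2 v == s.2 v)] && (val (t.2 s.1) == t.1)
  then m (s.2 s.1) (t.2 s.1) else 0.

(* The vertex reached at the last exit of the trajectory [X] from [v] before
   time [n], and [r0 v] if there was none. *)
Fixpoint last_exit (X : nat -> V) (r0 : V -> V) (n : nat) (v : V) : V :=
  if n is k.+1 then
    if X k == v then X k.+1 else last_exit X r0 k v
  else r0 v.

Variables (d : measure_display) (Omega : measurableType d).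
Variable P : probability Omega R.

(* The event (X_n, rho_n) = s. A trajectory may use non-edges of [E] on a null
   set, so rho_n is only a map V -> V and is compared with [s.2] pointwise. *)
Definition total_at (X : nat -> Omega -> V) (rho0 : Omega -> config E)
    (n : nat) (s : state) : set Omega :=
  [set w | X n w = s.1 /\
    forall v, last_exit (X ^~ w) (fun u => val (rho0 w u)) n v = val (s.2 v)].

(* The last clause is the Markov property with transition matrix
   [total_chain], multiplied out so that null events need no special care. *)
Definition locally_markov_walk
    (X : nat -> Omega -> V) (rho0 : Omega -> config E) : Prop :=
  [/\ forall n v, measurable (X n @^-1` [set v]),
      forall r, measurable (rho0 @^-1` [set r])
    & forall (n : nat) (s : nat -> state),
        P [set w | forall k, (k <= n.+1)%N -> total_at X rho0 k (s k) w] =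
        (P [set w | forall k, (k <= n)%N -> total_at X rho0 k (s k) w]
         * (total_chain (s n) (s n.+1))%:E)%E].

End LocallyMarkovWalk.

(* Main.v *)
Require Import Defs.
From HB Require Import structures.
From mathcomp Require Import all_boot all_order all_algebra.
From mathcomp Require Import all_classical all_reals all_analysis.

(* Call (x, rho) rooted if following rho from any vertex leads to x; this says
   that rho is a spanning unicycle with x on its cycle. Rooted states are
   recurrent since the measure prod_v pi_v (rho v), with pi_v invariant for the
   local chain at v, is invariant on them. Conversely, the walk started from a
   recurrent state can visit every vertex and return, and a vertex once visited
   is led to the walker ever after. *)

Set Implicit Arguments.
Unset Strict Implicit.
Unset Printing Implicit Defensive.

Import Order.TTheory GRing.Theory Num.Theory.
Import numFieldNormedType.Exports.

Local Open Scope ring_scope.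

(** * Recurrence and invariant measures of finite Markov chains *)

Section Chain.
Variables (R : realType) (S : finType) (p : S -> S -> R).
Hypothesis p_stoch : stochastic p.

Let p_ge0 s t : 0 <= p s t. Proof. by case: p_stoch. Qed.
Let p_sum s : \sum_t p s t = 1. Proof. by case: p_stoch. Qed.

(* P_t (Z_1 <> s, ..., Z_n <> s) for the chain Z started from t. *)
Fixpoint avoid (s : S) (n : nat) (t : S) : R :=
  if n is k.+1 then \sum_(u | u != s) p t u * avoid s k u else 1.

(** Freeing the starting point of [first_return] makes recursion on the first step possible. *)
Definition first_passage (s : S) (n : nat) (t : S) : R :=
  \sum_(w : n.-tuple S | s \notin w) path_prob p t (rcons w s).

Lemma first_passage0 s t : first_passage s 0 t = p t s.
Proof.
rewrite /first_passage (big_pred1 [tuple]) /= ?mulr1 // => w.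
by rewrite tuple0; apply/esym; exact: eqxx.
Qed.

Lemma first_passageS s n t :
  first_passage s n.+1 t = \sum_(u | u != s) p t u * first_passage s n u.
Proof.
under [RHS]eq_bigr do rewrite big_distrr /=.
rewrite pair_big_dep /= /first_passage.
rewrite (reindex (fun uw : S * n.-tuple S => [tuple of uw.1 :: uw.2])) /=.
  by apply: eq_bigl => -[u w] /=; rewrite inE negb_or eq_sym.
exists (fun w : n.+1.-tuple S => (thead w, [tuple of behead w])) => [[u w]|w] _ /=.
  by congr pair; apply: val_inj.
by apply: val_inj; case/tupleP: w => u w.
Qed.

Lemma sum_first_passage s n t :
  \sum_(k < n) first_passage s k t + avoid s n t = 1.
Proof.
elim: n t => [|n IHn] t; first by rewrite big_ord0 add0r.
rewrite big_ord_recl first_passage0 /=.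
under eq_bigr do rewrite first_passageS.
rewrite exchange_big /= -addrA -big_split /= -[RHS](p_sum t) [RHS](bigD1 s) //=.
congr (_ + _); apply: eq_bigr => u _.
by rewrite -big_distrr /= -mulrDr IHn mulr1.
Qed.

Lemma avoid_ge0 s n t : 0 <= avoid s n t.
Proof.
by elim: n t => [|n IHn] t //=; apply: sumr_ge0 => u _; rewrite mulr_ge0.
Qed.

Lemma series_first_return s : series (first_return p s) = fun n => 1 - avoid s n s.
Proof.
apply/funext => n; rewrite -(sum_first_passage s n s) addrK /series /=.
by rewrite big_mkord.
Qed.

Lemma recurrent_avoid s : recurrent p s <-> (avoid s ^~ s @ \oo --> (0 : R))%classic.
Proof.
rewrite /recurrent series_first_return; split => h.
  have -> : avoid s ^~ s = fun n => 1 - (1 - avoid s n s).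
    by apply/funext => n; rewrite subKr.
  by rewrite -(subrr (1 : R)); apply: cvgB h; apply: cvg_cst.
by rewrite -[X in (_ --> X)%classic](subr0 (1 : R)); apply: cvgB h; apply: cvg_cst.
Qed.

(* Invariance makes sum_t mu t * avoid s n t drop by mu s * avoid s n s at each
   step, so avoid s n s is summable. *)
Lemma recurrent_of_invariant (mu : S -> R) s :
  (forall t, 0 <= mu t) -> (forall u, \sum_t mu t * p t u = mu u) ->
  0 < mu s -> recurrent p s.
Proof.
move=> mu_ge0 mu_inv mus_gt0; apply/recurrent_avoid.
pose b n := \sum_t mu t * avoid s n t.
have bS n : b n.+1 = b n - mu s * avoid s n s.
  rewrite /b /=; under eq_bigr do rewrite big_distrr /=.
  rewrite exchange_big /= [X in _ = X - _](bigD1 s) //= [X in X - _]addrC addrK.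
  apply: eq_bigr => u _; under eq_bigr do rewrite mulrA.
  by rewrite -big_distrl /= mu_inv.
have sumE n : \sum_(0 <= k < n) avoid s k s = (b 0%N - b n) / mu s.
  elim: n => [|n IHn]; first by rewrite big_geq // subrr mul0r.
  rewrite big_nat_recr //= IHn bS.
  rewrite opprB [in RHS]addrCA [in RHS]mulrDl [RHS]addrC.
  by rewrite [X in _ = _ + X]mulrAC divff ?gt_eqF // mul1r.
apply: cvg_series_cvg_0; apply: nondecreasing_is_cvgn.
  apply/nondecreasing_seqP => n.
  by rewrite /series /= big_nat_recr //= lerDl avoid_ge0.
exists (b 0%N / mu s) => _ [n _ <-].
rewrite /series /= sumE ler_pM2r ?invr_gt0 // gerBl.
by apply: sumr_ge0 => t _; rewrite mulr_ge0 // avoid_ge0.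
Qed.

Lemma recurrent_connect s t :
  recurrent p s -> connect [rel u v | 0 < p u v] s t ->
  connect [rel u v | 0 < p u v] t s.
Proof.
set e := [rel u v | _] => /recurrent_avoid avoid0 st.
(* The states from which s is avoided with probability bounded below: they
   contain every state that cannot reach s, exclude s itself, and are hence
   closed under predecessors. *)
pose bad u := exists2 c : R, 0 < c & forall n, c <= avoid s n u.
have s_good : ~ bad s.
  case=> c c_gt0 c_le.
  suff : c <= 0 by rewrite leNgt c_gt0.
  by apply: (cvgr_to_ge avoid0); apply: nearW.
have bad_back u v : e u v -> bad v -> bad u.
  move=> /= uv badv; have [c c_gt0 c_le] := badv.
  have vs : v != s by apply/eqP => vs; apply: s_good; rewrite -vs.
  (* The [1] covers [n = 0]; for larger [n], stepping to [v] and then avoiding [s] contributes at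
     least [p u v * c]. *)
  exists (Num.min 1 (p u v * c)) => [|[|n]] /=.
  - by rewrite lt_min ltr01 mulr_gt0.
  - by rewrite ge_min lexx.
  - rewrite ge_min (bigD1 v) //=; apply/orP; right.
    apply: (le_trans (ler_wpM2l (p_ge0 u v) (c_le n))).
    by rewrite lerDl sumr_ge0 // => w _; rewrite mulr_ge0 // avoid_ge0.
apply/negPn/negP => ts; apply: s_good.
have badt : bad t.
  exists 1 => // n; have : ~~ connect e t s by [].
  elim: n t {st ts} => [|n IHn] t ts //=.
  rewrite -{1}(p_sum t) (bigID (fun u => u != s)) /=.
  rewrite [X in _ + X]big1 ?addr0 => [|u /negPn/eqP ->]; last first.
    apply/eqP; rewrite eq_le p_ge0 andbT leNgt; apply: contra ts => ts.
    exact: connect1.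
  apply: ler_sum => u us.
  case: (ltgtP (p t u) 0) (p_ge0 t u) => // [tu _|-> _]; last by rewrite mul0r.
  rewrite ler_peMr ?p_ge0 // IHn //.
  by apply: contra ts; apply: connect_trans; apply: connect1.
case/connectP: st badt => q + ->.
(* Badness travels backwards along the path from [s] to [t]. Only the start of the path is
   generalized; the state avoided in [bad] stays [s]. *)
elim: q {1 2 3}s => [|v q IHq] u //= /andP[uv vq] badt.
by apply: (bad_back u v uv); apply: IHq.
Qed.

End Chain.

(* The absolute value w of a left fixed vector satisfies w <= w p pointwise, with
   equal total masses. *)
Lemma stochastic_invariant (R : realType) (T : finType) (p : T -> T -> R) :
  stochastic p -> T -> exists2 mu : T -> R, (forall t, 0 <= mu t) /\ (exists t, 0 < mu t)
    & forall u, \sum_t mu t * p t u = mu u.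
Proof.
move=> [p_ge0 p_sum] t0.
pose A : 'M[R]_#|T| := \matrix_(i, j) p (enum_val i) (enum_val j) - 1%:M.
have A1 : A *m const_mx 1 = 0 :> 'cV_#|T|.
  apply/matrixP => i j; rewrite mulmxBl mul1mx !mxE.
  under eq_bigr do rewrite !mxE mulr1.
  apply/eqP; rewrite subr_eq0 -(p_sum (enum_val i)) eq_sym; apply/eqP.
  by apply: reindex; exists enum_rank => ? _; rewrite ?enum_rankK ?enum_valK.
(* [det0P] speaks of left null vectors: the constant vector is one for the transpose of [A], so the
   determinant vanishes and [A] has one too. *)
have /eqP/det0P [v v_neq0 vA] : \det A = 0.
  apply/eqP; rewrite -det_tr; apply/det0P; exists (const_mx 1).
    apply/eqP => /matrixP /(_ ord0 (enum_rank t0)); rewrite !mxE.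
    by apply/eqP; rewrite oner_eq0.
  by rewrite -trmx_const -trmx_mul A1 trmx0.
pose w t := v ord0 (enum_rank t).
have w_inv u : \sum_t w t * p t u = w u.
  move/matrixP: vA => /(_ ord0 (enum_rank u)); rewrite mulmxBr mulmx1 !mxE.
  move/eqP; rewrite subr_eq0 => /eqP; rewrite -[w u]/(v ord0 (enum_rank u)) => <-.
  rewrite (reindex (@enum_val T T)) /=; last first.
    by exists enum_rank => ? _; rewrite ?enum_rankK ?enum_valK.
  by apply: eq_bigr => i _; rewrite !mxE enum_rankK /w enum_valK.
have w_le u : 0 <= \sum_t `|w t| * p t u - `|w u|.
  rewrite subr_ge0 -{1}w_inv; apply: le_trans (ler_norm_sum _ _ _) _.
  by apply: ler_sum => t _; rewrite normrM (ger0_norm (p_ge0 _ _)).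
exists (fun t => `|w t|); first split=> //.
  apply/existsP; apply: contraNT v_neq0 => /existsPn w0.
  apply/eqP/matrixP => i j; rewrite mxE ord1.
  by apply/eqP; have := w0 (enum_val j); rewrite normr_gt0 negbK /w enum_valK.
have /psumr_eq0P sum0 : \sum_u (\sum_t `|w t| * p t u - `|w u|) = 0.
  rewrite sumrB exchange_big /= -sumrB big1 // => t _.
  by rewrite -big_distrr /= p_sum mulr1 subrr.
by move=> u; apply/eqP; rewrite -subr_eq0; apply/eqP; apply: sum0.
Qed.

Lemma nstep_ge0 (R : realType) (T : finType) (p : T -> T -> R) n s t :
  stochastic p -> 0 <= nstep p n s t.
Proof.
case=> p_ge0 _; elim: n s => [|n IHn] s /=; first exact: ler0n.
by apply: sumr_ge0 => u _; rewrite mulr_ge0.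
Qed.

(** Invariance under [p] passes to all its powers, so mass at one state [t] spreads to every state
    that [t] reaches. *)
Lemma irreducible_invariant (R : realType) (T : finType) (p : T -> T -> R) :
  stochastic p -> irreducible p -> exists2 mu : T -> R, (forall t, 0 < mu t)
    & forall u, \sum_t mu t * p t u = mu u.
Proof.
move=> p_stoch p_irr; have [p_ge0 _] := p_stoch.
case: (pickP T) => [t0 _|T0]; last by exists (fun=> 1) => [//|u]; have := T0 u.
have [mu [mu_ge0 [t mut_gt0]] mu_inv] := stochastic_invariant p_stoch t0.
exists mu => // u; have [n ntu] := p_irr t u.
have <- : \sum_s mu s * nstep p n s u = mu u.
  elim: n {ntu} => [|n <-] /=.
    rewrite (bigD1 u) //= eqxx mulr1 big1 ?addr0 // => s /negPf ->.
    by rewrite mulr0.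
  under eq_bigr do rewrite big_distrr /=.
  rewrite exchange_big /=; apply: eq_bigr => s _.
  by under eq_bigr do rewrite mulrA; rewrite -big_distrl /= mu_inv.
rewrite (bigD1 t) //= ltr_wpDr ?mulr_gt0 //.
by apply: sumr_ge0 => s _; rewrite mulr_ge0 ?nstep_ge0.
Qed.

(** * Functional graphs and their cycles *)

(** Up to its first arrival at [x], the path never uses the arrow at [x]. *)
Lemma fconnect_eq_off (V : finType) (f g : V -> V) (x v : V) :
  (forall w, w != x -> f w = g w) -> fconnect f v x -> fconnect g v x.
Proof.
move=> fg /iter_findex; move: (findex f v x) => n; elim: n v => [v <- //|n IHn] v.
rewrite iterSr; have [-> _ //|vx] := eqVneq v x.
by move/IHn => gfvx; apply: connect_trans gfvx; rewrite fg // fconnect1.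
Qed.

Section FunctionalGraph.
Variables (V : finType) (f : V -> V).

(** Every forward orbit runs into a cycle, which must be the one through [x] if there is only one.
    Conversely, a cycle is closed under [f], so if everything leads to [x] it contains [x] and is a
    rotation of its orbit. *)
Lemma unique_dicycle_on_cycleP (x : V) :
  (unique_dicycle (frel f) /\ exists2 c, dicycle (frel f) c & x \in c) <->
  (forall v, fconnect f v x).
Proof.
have dicycle_orbit y : fcycle f (orbit f y) -> dicycle (frel f) (orbit f y).
  by move=> cy; split; [rewrite -size_eq0 size_orbit -lt0n order_gt0
                       |rewrite /ucycle cy orbit_uniq].
split=> [[[c0 _ c0_uniq] [c cc xc]] v|to_x].
  have /trajectP [i lt_i ei] := looping_order f v.
  (* The numerals select clauses of the equivalence [orbitPcycle]: here 0, the orbit is a cycle, and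
     3, some positive iterate returns. *)
  have /dicycle_orbit ov : fcycle f (orbit f (iter i f v)).
    apply/(orbitPcycle 0%N 3%N) => /=; exists (order f v - i.+1)%N.
    by rewrite -iterS -iterD addSnnS subnK.
  have [k ok] := c0_uniq _ ov; have [l cl] := c0_uniq _ cc.
  apply: connect_trans (fconnect_iter f i v) _.
  by rewrite fconnect_orbit ok mem_rot -(mem_rot l) -cl.
have cx : fcycle f (orbit f x) by apply/(orbitPcycle 0%N 2%N); apply: to_x.
split; last by exists (orbit f x); [apply: dicycle_orbit | rewrite in_orbit].
exists (orbit f x) => [|c [c0 /andP[fc uc]]]; first exact: dicycle_orbit.
case: c c0 fc uc => // v c _ fc uc.
have xc : x \in v :: c by rewrite -(fconnect_cycle fc (mem_head v c)).
have [i ->] := orbit_rot_cycle fc uc xc.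
by exists (size (rot i (v :: c)) - i)%N; rewrite -/(rotr i _) rotK.
Qed.

Lemma f_finv_fconnect (y : V) : fconnect f (f y) y -> f (finv f y) = y.
Proof. by rewrite /finv -iterS orderSpred => /(orbitPcycle 2%N 4%N). Qed.

(** Here [y] is periodic, and [f] is injective on a periodic orbit even if not globally; this
    identifies the previous position of the walk. *)
Lemma finv_fconnect (x y : V) : fconnect f y x -> f x = y -> x = finv f y.
Proof.
move=> yx fxy; have iter_y : exists k, iter k.+1 f y = y.
  by exists (findex f y x); rewrite iterS iter_findex.
have /(orbitPcycle 3%N 5%N) f_inj := iter_y.
apply: f_inj; rewrite -?fconnect_orbit ?fconnect_finv // fxy.
by rewrite /finv -iterS orderSpred; apply/esym/(orbitPcycle 3%N 4%N).
Qed.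

End FunctionalGraph.

(** * Recurrent states of the total chain *)

Section TotalChain.
Variables (R : realType) (V : finType) (E : rel V).
Variable m : forall x : V, nbr E x -> nbr E x -> R.
Hypothesis m_stoch : forall x : V, stochastic (@m x).
Hypothesis m_irr : forall x : V, irreducible (@m x).

Let m_ge0 x (y z : nbr E x) : 0 <= m y z. Proof. by case: (m_stoch x). Qed.
Let m_sum x (y : nbr E x) : \sum_z m y z = 1. Proof. by case: (m_stoch x). Qed.

Definition rotor (rho : config E) (v : V) : V := val (rho v).

Definition redirect (rho : config E) (x : V) (z : nbr E x) : config E :=
  finfun (@eqtype.dfwith V (nbr E) rho x z).

Definition walk_to (s : state E) (z : nbr E s.1) : state E :=
  (val z, redirect s.2 z).

Definition rooted (s : state E) : bool :=
  [forall v, fconnect (rotor s.2) v s.1].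

Lemma redirect_in rho x (z : nbr E x) : redirect rho z x = z.
Proof. by rewrite ffunE dfwith_in. Qed.

Lemma redirect_out rho x (z : nbr E x) v : v != x -> redirect rho z v = rho v.
Proof. by move=> vx; rewrite ffunE dfwith_out // eq_sym. Qed.

Lemma redirect_eqP (rho eta : config E) x :
  reflect (forall v, v != x -> eta v = rho v) (eta == redirect rho (eta x)).
Proof.
apply: (iffP eqP) => [-> v vx|eq_off]; first by rewrite redirect_out.
apply/ffunP => v; have [->|vx] := eqVneq v x; first by rewrite redirect_in.
by rewrite redirect_out // eq_off.
Qed.

(** A successor of [s] is determined by its arrow at [s.1]; in this form sums over successors can be
    reindexed by neighbours. *)
Lemma total_chainE s t :
  total_chain m s t =
  if t == walk_to (t.2 s.1) then m (s.2 s.1) (t.2 s.1) else 0.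
Proof.
rewrite /total_chain; congr (if _ then _ else _).
rewrite [t in RHS]surjective_pairing xpair_eqE eq_sym andbC; congr andb.
apply/forallP/redirect_eqP => eq_off v; last by apply/implyP => /eq_off ->.
by move=> vx; apply/eqP; have /implyP := eq_off v; apply.
Qed.

Lemma total_chain_walk_to s (z : nbr E s.1) :
  total_chain m s (walk_to z) = m (s.2 s.1) z.
Proof. by rewrite total_chainE /= redirect_in eqxx. Qed.

Lemma total_chain_stochastic : stochastic (total_chain m).
Proof.
split=> [s t|s]; first by rewrite /total_chain; case: ifP.
under eq_bigr do rewrite total_chainE.
rewrite -big_mkcond /= (reindex_onto (@walk_to s) (fun t => t.2 s.1)) /=; last first.
  by move=> t /eqP.
rewrite -[RHS](m_sum (s.2 s.1)); apply: eq_big => z; last by rewrite redirect_in.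
by rewrite redirect_in !eqxx.
Qed.

Lemma total_chain_step s t : total_chain m s t != 0 ->
  [/\ forall v, v != s.1 -> t.2 v = s.2 v, rotor t.2 s.1 = t.1
    & 0 < m (s.2 s.1) (t.2 s.1)].
Proof.
rewrite total_chainE; case: ifP => [/eqP ts m_neq0|_]; last by rewrite eqxx.
split; last by rewrite lt_neqAle eq_sym m_neq0 m_ge0.
  by move=> v vs; rewrite ts redirect_out.
by rewrite [in RHS]ts.
Qed.

(* The part of the configuration leading to the walker is unaffected by a step,
   whose new arrow joins the old position to the new one. *)
Lemma fconnect_step s t v : total_chain m s t != 0 ->
  fconnect (rotor s.2) v s.1 -> fconnect (rotor t.2) v t.1.
Proof.
move=> /total_chain_step [eq_off <- _] vs; apply: connect_trans (fconnect1 _ _).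
by apply: fconnect_eq_off vs => w ws; rewrite /rotor eq_off.
Qed.

(* The product of the local invariant measures, restricted to rooted states, is
   invariant: the only possible previous position is the predecessor of the
   current one on the cycle, with an arbitrary arrow there. *)
Lemma rooted_recurrent s : rooted s -> recurrent (total_chain m) s.
Proof.
move=> s_rooted.
pose pi_ x := sval (cid2 (irreducible_invariant (m_stoch x) (@m_irr x))).
have pi_gt0 x z : 0 < pi_ x z by rewrite /pi_; case: cid2 => /= pi h _; apply: h.
have pi_inv x z : \sum_y pi_ x y * m y z = pi_ x z.
  by rewrite /pi_; case: cid2 => /= pi _; apply.
clearbody pi_.
pose mu (t : state E) := if rooted t then \prod_v pi_ v (t.2 v) else 0.
have prod_gt0 (rho : config E) : 0 < \prod_v pi_ v (rho v).
  by apply: prodr_gt0 => v _; apply: pi_gt0.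
apply: (recurrent_of_invariant total_chain_stochastic (mu := mu)).
- by move=> t; rewrite /mu; case: ifP => // _; apply/ltW.
- move=> t; have [t_rooted|t_rooted] := boolP (rooted t); last first.
    rewrite [RHS]/mu (negPf t_rooted) big1 // => u _; rewrite /mu.
    case: ifP => [u_rooted|_]; last by rewrite mul0r.
    have [->|ut] := eqVneq (total_chain m u t) 0; first by rewrite mulr0.
    case/negP: t_rooted; apply/forallP => v.
    by apply: fconnect_step ut _; apply/forallP: v.
  have t_conn v : fconnect (rotor t.2) v t.1 by apply/forallP: v.
  pose x := finv (rotor t.2) t.1.
  have rotor_x : rotor t.2 x = t.1 by apply/f_finv_fconnect/t_conn.
  pose back (z : nbr E x) : state E := (x, redirect t.2 z).
  rewrite (bigID (fun u : state E => u == back (u.2 x))) /= [X in _ + X]big1; last first.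
    move=> u; have [->|ut] := eqVneq (total_chain m u t) 0; first by rewrite mulr0.
    rewrite /mu; case: ifP => [/forallP u_rooted|_]; last by rewrite mul0r.
    have [eq_off rotor_u _] := total_chain_step ut.
    (* The arrows of [u] lead from [t.1] to [u.1], and so do those of [t], which differ only at
       [u.1]; hence [u.1] precedes [t.1] on the cycle of [t.2]. *)
    have ux : u.1 = x.
      apply: finv_fconnect rotor_u; apply: fconnect_eq_off (u_rooted t.1) => w wu.
      by rewrite /rotor eq_off.
    case/negP; rewrite {1}[u]surjective_pairing ux xpair_eqE eqxx /=.
    by apply/redirect_eqP => v; rewrite -ux => /eq_off ->.
  rewrite addr0 (reindex_onto back (fun u => u.2 x)) /=; last by move=> u /eqP.
  (* Only the factor at [x] depends on [z], so the sum reduces to the invariance of [pi_ x]. *)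
  rewrite /mu t_rooted (bigD1 x) //= -(pi_inv x) big_distrl /=.
  apply: eq_big => [z|z _]; first by rewrite redirect_in !eqxx.
  rewrite ifT; last first.
    apply/forallP => v /=; apply: (@fconnect_eq_off _ (rotor t.2)) => [w wx|].
      by rewrite /rotor redirect_out.
    exact: connect_trans (t_conn v) (fconnect_finv _ _).
  rewrite (bigD1 x) //= redirect_in mulrAC; congr (_ * _ * _).
    rewrite total_chainE /= redirect_in ifT //; apply/eqP.
    rewrite [LHS]surjective_pairing /walk_to /= -rotor_x; congr pair.
    by apply/eqP/redirect_eqP => v vx; rewrite redirect_out.
  by apply: eq_bigr => v vx; rewrite redirect_out.
by rewrite /mu s_rooted.
Qed.

Let step := [rel s t | 0 < total_chain m s t].

(** Stop the walk at its first visit to [x]: the arrow there has not been touched yet. *)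
Lemma connect_same_rotor s x rho : connect step s (x, rho) ->
  exists2 eta, connect step s (x, eta) & eta x = s.2 x.
Proof.
case/connectP => q; elim: q s => [|t q IHq] s /=.
  by move=> _ <-; exists rho.
case/andP => st tq qE; have [<-|sx] := eqVneq s.1 x.
  by exists s.2; rewrite -?surjective_pairing.
have [eta t_eta etax] := IHq t tq qE.
exists eta; first exact: connect_trans (connect1 st) t_eta.
have [eq_off _ _] := total_chain_step (lt0r_neq0 st).
by rewrite etax eq_off // eq_sym.
Qed.

(* A recurrent state returns from every visited state, so the arrows used at a
   visited vertex exhaust its neighbours and all vertices are visited; the set
   of vertices led to the walker only grows along the walk back. *)
Lemma recurrent_rooted s :
  strongly_connected E -> recurrent (total_chain m) s -> rooted s.
Proof.
move=> E_conn s_rec.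
have back t : connect step s t -> connect step t s.
  exact: recurrent_connect total_chain_stochastic s t s_rec.
pose vis x rho := connect step s (x, rho).
have vis_walk x rho (z : nbr E x) : vis x rho -> 0 < m (rho x) z ->
    vis (val z) (redirect rho z).
  move=> xv mz; apply: connect_trans xv (connect1 _) => /=.
  by rewrite -[X in total_chain m _ X]/(@walk_to (x, rho) z) total_chain_walk_to.
(* Each step of the local chain at [x] is realized by one excursion of the walk from [x] back to
   [x]. *)
have vis_nstep x n (z : nbr E x) rho : vis x rho -> 0 < nstep (@m x) n (rho x) z ->
    exists2 eta, vis x eta & eta x = z.
  elim: n rho => [|n IHn] rho xv /=.
    by case: eqP => [<- _|_]; [exists rho | rewrite ltxx].
  move=> sum_gt0; have [y /andP [my ny]] :
      exists y, (0 < m (rho x) y) && (0 < nstep (@m x) n y z).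
    apply/existsP; apply: contraLR sum_gt0 => /existsPn none.
    rewrite -leNgt; apply: sumr_le0 => y _.
    have := none y; rewrite negb_and -!leNgt => /orP [my|ny].
      by rewrite mulr_le0_ge0 ?nstep_ge0.
    by rewrite mulr_ge0_le0.
  have yv := vis_walk _ _ _ xv my.
  (* The walk can return to [x] by way of [s], and on its first arrival the arrow at [x] is still
     [y]. *)
  have [eta eta_conn etax] := connect_same_rotor (connect_trans (back _ yv) xv).
  have etav : vis x eta := connect_trans yv eta_conn.
  by apply: (IHn eta etav); rewrite etax /= redirect_in.
have vis_nbr x y rho : vis x rho -> E x y -> exists eta, vis y eta.
  move=> xv xy; pose z : nbr E x := exist _ y xy.
  have [mu mu_gt0 mu_inv] := irreducible_invariant (m_stoch x) (@m_irr x).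
  (* Moving to [y] requires an arrow [w] from which the local chain can jump to [z]; without one,
     invariance would give [z] no mass. *)
  have [w mw] : exists w, 0 < m w z.
    apply/existsP; apply: contraTT (mu_gt0 z) => /existsPn none.
    rewrite -leNgt -mu_inv sumr_le0 // => w _.
    by rewrite mulr_ge0_le0 ?(ltW (mu_gt0 w)) // leNgt none.
  have [n nw] := @m_irr x (rho x) w.
  have [eta etav etax] := vis_nstep x n w rho xv nw.
  by exists (redirect eta z); apply: (vis_walk x eta z etav); rewrite etax.
apply/forallP => v; have [rho vv] : exists rho, vis v rho.
  case/connectP: (E_conn s.1 v) => q + ->.
  have : exists rho, vis s.1 rho by exists s.2; rewrite /vis -surjective_pairing connect0.
  elim: q {1 2 3}s.1 => [|y q IHq] x //= [rho xv] /andP [xy yq].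
  by apply: (IHq y _ yq); apply: vis_nbr xv xy.
(* At [(v, rho)] the walker stands at [v] itself; this connection is carried along the walk back to
   [s]. *)
have : fconnect (rotor rho) v v by [].
case/connectP: (back _ vv) => q.
rewrite -[X in fconnect (rotor X)]/((v, rho).2) -[X in fconnect _ _ X]/((v, rho).1).
elim: q (v, rho) => [|t q IHq] u /= ; first by move=> _ ->.
case/andP => ut tq sE uv; apply: IHq tq sE _.
exact: fconnect_step (lt0r_neq0 ut) uv.
Qed.

End TotalChain.

Theorem proposition3p3 (R : realType) (V : finType) (E : rel V)
    (E_loopless : irreflexive E) (E_conn : strongly_connected E)
    (V_ge2 : (2 <= #|V|)%N)
    (m : forall x : V, nbr E x -> nbr E x -> R)
    (m_stoch : forall x : V, stochastic (m x))
    (m_irr : forall x : V, irreducible (m x))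
    (m_aper : forall x : V, aperiodic (m x))
    (d : measure_display) (Omega : measurableType d) (P : probability Omega R)
    (X : nat -> Omega -> V) (rho0 : Omega -> config E)
    (X_walk : locally_markov_walk m P X rho0)
    (x : V) (rho : config E) :
  recurrent (total_chain m) (x, rho) <-> spanning_unicycle rho /\ on_cycle rho x.
Proof.
apply: (@iff_trans _ (rooted (x, rho))).
  by split; [apply: recurrent_rooted | apply: rooted_recurrent].
apply: (@iff_trans _ (forall v, fconnect (rotor rho) v x)).
  by split => [/forallP|?]; [|apply/forallP].
by apply: iff_sym; apply: unique_dicycle_on_cycleP.
Qed.
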